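(* Let $H$ be a finite dimensional semisimple Hopf algebra over $\mathbb{C}$, let $K$ be a normal Hopf subalgebra of $H$ and let $L=H//K$. Consider the equivalence relation $r^{H^*}_{L^*,k}$ on $\mathrm{Irr}(H)$, written $\sim$. Then for $\chi,\mu\in\mathrm{Irr}(H)$ one has $\chi\sim\mu$ if and only if the restrictions of $\chi$ and $\mu$ to $K$ have a common irreducible constituent.
   Context: $k=\mathbb{C}$. $\mathrm{Irr}(H)$ is the set of irreducible characters of $H$. $H//K=H/HK^+$, where $K^+=K\cap\ker\epsilon$; since $K$ is normal this is a quotient Hopf algebra $L$ of $H$, and the projection $\pi:H\to L$ dualizes to an injective Hopf algebra map $\pi^*:L^*\to H^*$, through which $L^*$ is regarded as a Hopf subalgebra of $H^*$. For $\chi\in\mathrm{Irr}(H)$ let $C_\chi\subset H^*$ be the simple subcoalgebra of $H^*$ associated to $\chi$ (the span of the matrix coefficients of the corresponding simple $H$-module). The equivalence relation $r^{H^*}_{L^*,k}$ on $\mathrm{Irr}(H)$ is defined by: $\chi\sim\mu$ if and only if $C_\chi\subset L^*C_\mu$ (product in $H^*$). Equivalently, $m_H(\chi,t_L\mu)>0$, where $t_L\in L^*\subset H^*$ is the integral of $L^*$ with $t_L(1)=\dim_k L$ (the regular character of $L$ viewed as a character of $H$), the product is that of $H^*$, and $m_H$ is the bilinear form on the span of the characters of $H$ with $m_H(\chi_M,\chi_N)=\dim_k\mathrm{Hom}_H(M,N)$ for $H$-modules $M,N$ with characters $\chi_M,\chi_N$. *)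

(* Defs.v *)
From HB Require Import structures.
From mathcomp Require Import all_boot all_order all_algebra all_field.
From mathcomp Require Import complex.
From mathcomp Require Import boolp classical_sets reals.

Set Implicit Arguments.
Unset Strict Implicit.
Unset Printing Implicit Defensive.

Import GRing.Theory.
Local Open Scope ring_scope.

(* Tensor products of finite dimensional spaces: U (x) V is modelled by the   *)
(* matrices of coordinates with respect to the products of the vectors of the *)
(* bases vbasis {:U} and vbasis {:V}.                                         *)
Notation tensor U V := ('M_(\dim {:U}%VS, \dim {:V}%VS)).

Notation dual V := ('Hom(V, _^o)).

Section Tensor.
Variable F : fieldType.

Definition canb (U : vectType F) (i : 'I_(\dim {:U})) : U := (vbasis {:U})`_i.

Definition pten (U V : vectType F) (u : U) (v : V) : tensor U V :=
  \matrix_(i, j) (coord (vbasis {:U}) i u * coord (vbasis {:V}) j v).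

(* The linear map on U (x) V induced by a bilinear b; in Sweedler notation,   *)
(* tlift b (comul h) is b(h_1, h_2).                                          *)
Definition tlift (U V W : vectType F) (b : U -> V -> W) (t : tensor U V) : W :=
  \sum_i \sum_j t i j *: b (canb i) (canb j).

Lemma canb_sum (U : vectType F) (u : U) :
  u = \sum_i coord (vbasis {:U}) i u *: canb i.
Proof. exact/coord_vbasis/memvf. Qed.

Lemma tlift_pten (U V W : vectType F) (b : U -> V -> W) (u : U) (v : V) :
    (forall y, linear (b^~ y)) -> (forall x, linear (b x)) ->
  tlift b (pten u v) = b u v.
Proof.
move=> bl br; have bZl a x y : b (a *: x) y = a *: b x y.
  have b0 : b 0 y = 0 by have := bl y (-1) 0 0; rewrite scaler0 addr0 scaleN1r addNr.
  by rewrite -[a *: x]addr0 bl b0 addr0.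
have bZr a x y : b x (a *: y) = a *: b x y.
  have b0 : b x 0 = 0 by have := br x (-1) 0 0; rewrite scaler0 addr0 scaleN1r addNr.
  by rewrite -[a *: y]addr0 br b0 addr0.
have bDl y : {morph b^~ y : x1 x2 / x1 + x2}.
  by move=> x1 x2; rewrite -[x1 in LHS]scale1r bl scale1r.
have bDr x : {morph b x : y1 y2 / y1 + y2}.
  by move=> y1 y2; rewrite -[y1 in LHS]scale1r br scale1r.
have b0l y : b 0 y = 0 by rewrite -(scale0r 0) bZl scale0r.
have b0r x : b x 0 = 0 by rewrite -(scale0r 0) bZr scale0r.
rewrite {2}(canb_sum u) (big_morph (b^~ v) (bDl v) (b0l v)).
apply: eq_bigr => i _; rewrite bZl {2}(canb_sum v).
rewrite (big_morph _ (bDr _) (b0r _)) scaler_sumr; apply: eq_bigr => j _.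
by rewrite bZr scalerA mxE.
Qed.

Lemma tlift_linear (U V W : vectType F) (b : U -> V -> W) : linear (tlift b).
Proof.
move=> a s t; rewrite /tlift scaler_sumr -big_split; apply: eq_bigr => i _ /=.
rewrite scaler_sumr -big_split; apply: eq_bigr => j _ /=.
by rewrite !mxE scalerDl scalerA.
Qed.

Definition tmap (U V U' V' : vectType F) (f : U -> U') (g : V -> V') :
    tensor U V -> tensor U' V' :=
  tlift (fun u v => pten (f u) (g v)).

Definition tassoc (U V W : vectType F) :
    tensor (tensor U V) W -> tensor U (tensor V W) :=
  tlift (fun t w => tlift (fun u v => pten u (pten v w)) t).

(* The image of A (x) B in U (x) V. *)
Definition tensv (U V : vectType F) (A : {vspace U}) (B : {vspace V}) :
    {vspace tensor U V} :=
  <<[seq pten a b | a <- vbasis A, b <- vbasis B]>>%VS.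

(* (a (x) b) (c (x) d) = ac (x) bd *)
Definition tmul (A B : falgType F) (s t : tensor A B) : tensor A B :=
  tlift (fun a b => tlift (fun c d => pten (a * c) (b * d)) t) s.

End Tensor.

HB.mixin Record Falgebra_isHopf (F : fieldType) H of Falgebra F H := {
  comul : 'Hom(H, tensor H H);
  counit : 'Hom(H, F^o);
  antipode : 'End(H);
  comulA : forall h : H,
    tassoc (tmap comul idfun (comul h)) = tmap idfun comul (comul h);
  counitl : forall h : H, tlift (fun a b : H => counit a *: b) (comul h) = h;
  counitr : forall h : H, tlift (fun a b : H => counit b *: a) (comul h) = h;
  comul1 : comul 1 = pten 1 1;
  comulM : forall g h : H, comul (g * h) = tmul (comul g) (comul h);
  counit1 : counit 1 = 1;
  counitM : forall g h : H, counit (g * h) = counit g * counit h;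
  antipodel : forall h : H,
    tlift (fun a b : H => antipode a * b) (comul h) = counit h *: 1;
  antipoder : forall h : H,
    tlift (fun a b : H => a * antipode b) (comul h) = counit h *: 1
}.

#[short(type="hopfAlgType")]
HB.structure Definition Hopf (F : fieldType) :=
  { H of Falgebra_isHopf F H & Falgebra F H }.

Section Algebra.
Variables (F : fieldType) (A : falgType F).

Definition left_ideal (I : {vspace A}) := ({:A} * I <= I)%VS.

(* The left regular module is semisimple. *)
Definition semisimple_alg :=
  forall I : {vspace A}, left_ideal I ->
    exists J : {vspace A},
      [/\ left_ideal J, (I + J = {:A})%VS & (I :&: J = 0)%VS].

(* Finite dimensional left modules, in coordinates: a acts on the column      *)
(* vectors of size rdeg by left multiplication by the matrix rmat a.          *)
Record repr := Repr {
  rdeg : nat;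
  rmat :> 'Hom(A, 'M[F]_rdeg);
  rmat1 : rmat 1 = 1%:M;
  rmatM : forall a b : A, rmat (a * b) = rmat a *m rmat b
}.

Definition submodule (V : repr) (U : {vspace 'cV[F]_(rdeg V)}) :=
  forall (a : A) (v : 'cV[F]_(rdeg V)), v \in U -> V a *m v \in U.

Definition simple_repr (V : repr) :=
  (0 < rdeg V)%N /\
  (forall U : {vspace 'cV[F]_(rdeg V)}, submodule U -> U = 0%VS \/ U = fullv).

Definition rchar (V : repr) : dual A := linfun (fun a => \tr (V a) : F^o).

Lemma rcharE (V : repr) a : rchar V a = \tr (V a).
Proof.
have lin : linear (fun a => \tr (V a) : F^o) by move=> c x y; rewrite !linearP.
pose f := GRing.isLinear.Build _ _ _ _ _ lin.
pose g : {linear A -> F^o} := HB.pack (fun a => \tr (V a) : F^o) f.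
by rewrite /rchar (lfunE g).
Qed.

Definition rcoef (V : repr) (i j : 'I_(rdeg V)) : dual A :=
  linfun (fun a => V a i j : F^o).

Lemma rcoefE (V : repr) i j a : @rcoef V i j a = V a i j.
Proof.
have lin : linear (fun a => V a i j : F^o).
  by move=> c x y; rewrite linearP !mxE.
pose f := GRing.isLinear.Build _ _ _ _ _ lin.
pose g : {linear A -> F^o} := HB.pack (fun a => V a i j : F^o) f.
by rewrite /rcoef (lfunE g).
Qed.

Definition coef_space (V : repr) : {vspace dual A} :=
  <<[seq rcoef i j | i <- enum 'I_(rdeg V), j <- enum 'I_(rdeg V)]>>%VS.

Definition Irr : set (dual A) :=
  [set chi | exists V : repr, simple_repr V /\ rchar V = chi]%classic.

(* C_chi. Over a field of characteristic 0 the simple module affording chi is *)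
(* unique up to isomorphism, so that the space of its matrix coefficients     *)
(* depends only on chi.                                                       *)
Definition simple_coalg (chi : dual A) : {vspace dual A} :=
  xget 0%VS
    [set C | exists V : repr,
       [/\ simple_repr V, rchar V = chi & C = coef_space V]]%classic.

Definition rhom (V W : repr) : {vspace 'M[F]_(rdeg W, rdeg V)} :=
  (\bigcap_(i < \dim {:A})
     lker (linfun (fun X : 'M[F]_(rdeg W, rdeg V) =>
             X *m V (canb i) - W (canb i) *m X)))%VS.

Lemma mem_rhom (V W : repr) (X : 'M[F]_(rdeg W, rdeg V)) :
  X \in rhom V W <-> forall a : A, X *m V a = W a *m X.
Proof.
have E i : linfun (fun X : 'M[F]_(rdeg W, rdeg V) =>
    X *m V (canb i) - W (canb i) *m X) X = X *m V (canb i) - W (canb i) *m X.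
  set f0 := (fun X => _ - _).
  have lin : linear f0.
    move=> c x y; rewrite /f0 mulmxDl mulmxDr -scalemxAl -scalemxAr.
    by rewrite scalerBr opprD addrACA.
  pose g : {linear _ -> _} := HB.pack f0 (GRing.isLinear.Build _ _ _ _ _ lin).
  exact: (lfunE g).
split=> [/subv_bigcapP XP a|XP].
  rewrite (canb_sum a) !linear_sum /= mulmx_suml.
  apply: eq_bigr => i _; rewrite !linearZ /= -scalemxAl; congr (_ *: _).
  by apply/eqP; rewrite -subr_eq0 -E -memv_ker; apply: XP.
apply/subv_bigcapP => i _; rewrite -memvE memv_ker E; apply/eqP.
by rewrite XP subrr.
Qed.

(* psi is in Irr A and m_A(psi, phi) = dim Hom_A(S, V) > 0, where S and V     *)
(* afford psi and phi.                                                        *)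
Definition irr_constituent (psi phi : dual A) :=
  exists S V : repr,
    [/\ simple_repr S, rchar S = psi, rchar V = phi
      & (0 < \dim (rhom S V))%N].

End Algebra.

(* Quotient of a space by a subspace, realized on a complement, with its      *)
(* projection.                                                                *)
Section Quotient.
Variables (F : fieldType) (V : vectType F) (U : {vspace V}).

Definition quotv : vectType F := subvs_of (U^C)%VS.

Definition quot_proj : 'Hom(V, quotv) :=
  (linfun (vsproj (U^C)%VS) \o daddv_pi (U^C)%VS U)%VF.

Lemma quot_projE x : vsval (quot_proj x) = daddv_pi (U^C)%VS U x.
Proof. by rewrite lfunE /= lfunE /= vsprojK // memv_pi. Qed.

Lemma lker_quot_proj : lker quot_proj = U.
Proof.
have capU : (U^C :&: U = 0)%VS by rewrite capvC capv_compl.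
have addU x : x \in (U^C + U)%VS by rewrite addvC addv_complf memvf.
apply/vspaceP => x; rewrite memv_ker -(inj_eq val_inj) /= quot_projE.
have dx := daddv_pi_add capU (addU x).
apply/eqP/idP => [x0 | Ux]; first by rewrite -dx x0 add0r memv_pi.
have dU : daddv_pi U (U^C)%VS x = x by rewrite daddv_pi_id // capvC.
by apply: (addIr x); rewrite add0r -[X in _ + X]dU.
Qed.

Lemma limg_quot_proj : limg quot_proj = fullv.
Proof.
apply/vspaceP => y; rewrite memvf; apply/memv_imgP; exists (vsval y).
  exact: memvf.
apply: val_inj; rewrite /= quot_projE daddv_pi_id ?subvsP //.
by rewrite capvC capv_compl.
Qed.

End Quotient.

Definition dual_map (F : fieldType) (V W : vectType F) (f : 'Hom(V, W)) :
    'Hom(dual W, dual V) :=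
  linfun (fun g : dual W => (g \o f)%VF : dual V).

Lemma dual_mapE (F : fieldType) (V W : vectType F) (f : 'Hom(V, W))
  (g : dual W) : dual_map f g = (g \o f)%VF.
Proof.
have lin : linear (fun g : dual W => (g \o f)%VF : dual V).
  by move=> c x y; rewrite comp_lfunDl comp_lfunZl.
pose k : {linear dual W -> dual V} := HB.pack
  (fun g : dual W => (g \o f)%VF : dual V)
  (GRing.isLinear.Build _ _ _ _ _ lin).
exact: (lfunE k).
Qed.

Section Hopf.
Variables (F : fieldType) (H : hopfAlgType F).

(* An {aspace H} may have a unit other than 1. *)
Definition hopf_subalgebra (K : {aspace H}) :=
  [/\ 1 \in K,
      (comul @: K <= tensv K K)%VS
    & (antipode @: K <= K)%VS].

Definition hopf_normal (K : {aspace H}) :=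
  forall h x : H, x \in K ->
    tlift (fun a b : H => a * x * antipode b) (comul h) \in K /\
    tlift (fun a b : H => antipode a * x * b) (comul h) \in K.

Definition aug (K : {aspace H}) : {vspace H} := (K :&: lker counit)%VS.

Definition hquot (K : {aspace H}) : vectType F := quotv ({:H} * aug K)%VS.

Definition hquot_proj (K : {aspace H}) : 'Hom(H, hquot K) :=
  quot_proj ({:H} * aug K)%VS.

(* L^* for L = H // K, inside H^*. *)
Definition hquot_dual (K : {aspace H}) : {vspace dual H} :=
  limg (dual_map (hquot_proj K)).

Definition conv (f g : dual H) : dual H :=
  linfun (fun h => tlift (fun a b : H => f a * g b : F^o) (comul h)).

Lemma convE f g h :
  conv f g h = tlift (fun a b : H => f a * g b : F^o) (comul h).
Proof.
have lin : linear (fun h => tlift (fun a b : H => f a * g b : F^o) (comul h)).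
  by move=> c x y; rewrite linearP tlift_linear.
pose k : {linear H -> F^o} := HB.pack
  (fun h => tlift (fun a b : H => f a * g b : F^o) (comul h))
  (GRing.isLinear.Build _ _ _ _ _ lin).
exact: (lfunE k).
Qed.

Definition convv (A B : {vspace dual H}) : {vspace dual H} :=
  <<[seq conv a b | a <- vbasis A, b <- vbasis B]>>%VS.

Definition irr_rel (K : {aspace H}) (chi mu : dual H) :=
  (simple_coalg chi <= convv (hquot_dual K) (simple_coalg mu))%VS.

Definition res (K : {aspace H}) (chi : dual H) : dual (subvs_of K) :=
  (chi \o linfun (vsval : subvs_of K -> H))%VF.

Lemma resE (K : {aspace H}) (chi : dual H) x : res K chi x = chi (vsval x).
Proof. by rewrite /res lfunE /= lfunE. Qed.

End Hopf.

(* Main.v *)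
Require Import Defs.
From HB Require Import structures.
From mathcomp Require Import all_boot all_order all_algebra all_field.
From mathcomp Require Import complex.
From mathcomp Require Import boolp classical_sets reals.

(** Let V and W afford chi and mu, and let t be an integral of K with eps t = 1.
    It exists because K is normal: if an integral t had eps t = 0, then
    t g t = g1 (S(g2) t g3) t = 0 for all g, as S(g2) t g3 lies in the kernel of
    eps on K, and H t would be a left ideal of square zero in the semisimple H.
    The operator X |-> t1 X S(t2) projects Hom(A, B) onto Hom_K(A, B), and its
    trace depends only on the characters of A and B, so that constituents of
    restrictions to K can be read off the restricted modules themselves.

    An element of L^* is a multiple of eps on K, so C_V <= L^* C_W makes the
    coefficients of V on K combinations of those of W.  If moreover S is a simple
    K-submodule of V with Hom_K(S, W) = 0, then t1 X S(t2) = 0 for all X gives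
    1 = t1 S(t2) = 0 on S.

    Conversely a common constituent gives a nonzero K-map phi : W -> V.  The map
    psi(a) = V(a1) phi W(S(a2)) vanishes on H K^+, and V(h) phi = psi(h1) W(h2);
    as V is generated by the image of phi and H K^+ is a two-sided ideal, the
    coefficients of V lie in L^* C_W. *)

Set Implicit Arguments.
Unset Strict Implicit.
Unset Printing Implicit Defensive.

Import GRing.Theory.
Local Open Scope ring_scope.

(** * Sweedler calculus *)

(* A named copy of [linear], on which the tactic [lin] below can match. *)
Definition lin (F : fieldType) (U V : lmodType F) (f : U -> V) := linear f.

Section Linearity.
Variable F : fieldType.
Implicit Types U V W : lmodType F.

Lemma lin_id U : lin (fun x : U => x).
Proof. by []. Qed.

Lemma lin_hom U (V W : vectType F) (g : 'Hom(V, W)) (f : U -> V) :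
  lin f -> lin (fun x => g (f x)).
Proof. by move=> fl a x y; rewrite fl linearP. Qed.

Lemma lin_mull U (A : falgType F) (f : U -> A) (c : A) :
  lin f -> lin (fun x => f x * c).
Proof. by move=> fl a x y; rewrite fl mulrDl scalerAl. Qed.

Lemma lin_mulr U (A : falgType F) (f : U -> A) (c : A) :
  lin f -> lin (fun x => c * f x).
Proof. by move=> fl a x y; rewrite fl mulrDr scalerAr. Qed.

Lemma lin_fmull U (f : U -> F^o) (c : F) : lin f -> lin (fun x => f x * c : F^o).
Proof. by move=> fl a x y; rewrite fl mulrDl -mulrA. Qed.

Lemma lin_fmulr U (f : U -> F^o) (c : F) : lin f -> lin (fun x => c * f x : F^o).
Proof. by move=> fl a x y; rewrite fl mulrDr mulrCA. Qed.

Lemma lin_scalel U V (f : U -> F^o) (c : V) : lin f -> lin (fun x => f x *: c).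
Proof. by move=> fl a x y; rewrite fl scalerDl -scalerA. Qed.

Lemma lin_scaler U V (f : U -> V) (c : F) : lin f -> lin (fun x => c *: f x).
Proof. by move=> fl a x y; rewrite fl scalerDr !scalerA mulrC. Qed.

Lemma lin_fscaler U (f : U -> F^o) (c : F) :
  lin f -> lin (fun x => c *: (f x : F^o) : F^o).
Proof. exact: lin_scaler. Qed.

Lemma lin_sum U V I (r : seq I) (f : I -> U -> V) :
  (forall i, lin (f i)) -> lin (fun x => \sum_(i <- r) f i x).
Proof.
move=> fl a x y; rewrite scaler_sumr -big_split; apply: eq_bigr => i _.
exact: fl.
Qed.

Lemma lin_mulmxl U m n p (f : U -> 'M[F]_(m, n)) (c : 'M[F]_(n, p)) :
  lin f -> lin (fun x => f x *m c).
Proof. by move=> fl a x y; rewrite fl mulmxDl -scalemxAl. Qed.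

Lemma lin_mulmxr U m n p (f : U -> 'M[F]_(m, n)) (c : 'M[F]_(p, m)) :
  lin f -> lin (fun x => c *m f x).
Proof. by move=> fl a x y; rewrite fl mulmxDr -scalemxAr. Qed.

Lemma lin_mxE U m n (f : U -> 'M[F]_(m, n)) i j :
  lin f -> lin (fun x => f x i j : F^o).
Proof. by move=> fl a x y; rewrite fl !mxE. Qed.

Lemma lin_mxtrace U n (f : U -> 'M[F]_n) :
  lin f -> lin (fun x => \tr (f x) : F^o).
Proof. by move=> fl a x y; rewrite fl linearP. Qed.

Lemma lin_coord U (V : vectType F) n (X : n.-tuple V) i (f : U -> V) :
  lin f -> lin (fun x => coord X i (f x) : F^o).
Proof. by move=> fl a x y; rewrite fl linearP. Qed.

Section Consequences.
Variables (U V : lmodType F) (f : U -> V).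
Hypothesis fl : lin f.

Lemma lin0 : f 0 = 0.
Proof. by have := fl (-1) 0 0; rewrite scaler0 addr0 scaleN1r addNr. Qed.

Lemma linZ a x : f (a *: x) = a *: f x.
Proof. by rewrite -[a *: x]addr0 fl lin0 addr0. Qed.

Lemma linsum I (r : seq I) (g : I -> U) :
  f (\sum_(i <- r) g i) = \sum_(i <- r) f (g i).
Proof.
apply: (big_morph f _ lin0) => x y.
by rewrite -[x in LHS]scale1r fl scale1r.
Qed.

End Consequences.
End Linearity.

Lemma pten_linr (F : fieldType) (U V : vectType F) (u : U) :
  lin (fun v : V => pten u v).
Proof.
by move=> a x y; apply/matrixP=> i j; rewrite !mxE linearP mulrDr mulrCA.
Qed.

(* [sw b h] is b(h1, h2) in Sweedler notation. *)
Definition sw (F : fieldType) (H : hopfAlgType F) (W : vectType F)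
  (b : H -> H -> W) (h : H) : W := tlift b (comul h).

Section Sweedler0.
Variables (F : fieldType) (H : hopfAlgType F).
Implicit Types (W : vectType F) (h g : H).

Lemma lin_sw_arg (U : lmodType F) W (b : H -> H -> W) (f : U -> H) :
  lin f -> lin (fun x => sw b (f x)).
Proof. by move=> fl a x y; rewrite fl /sw linearP tlift_linear. Qed.

Lemma lin_sw (U : lmodType F) W (b : U -> H -> H -> W) h :
  (forall p q, lin (fun x => b x p q)) -> lin (fun x => sw (b x) h).
Proof.
move=> bl; apply: lin_sum => i; apply: lin_sum => j; apply: lin_scaler.
exact: bl.
Qed.

Lemma eq_sw W (b c : H -> H -> W) h :
  (forall p q, b p q = c p q) -> sw b h = sw c h.
Proof.
by move=> e; apply: eq_bigr => i _; apply: eq_bigr => j _; rewrite e.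
Qed.

End Sweedler0.

(* With values in [F] rather than [F^o], [eps h *: x] is a scaling over [F], *)
(* as the rewriting rules for [*:] need.                                     *)
Definition eps (F : fieldType) (H : hopfAlgType F) (h : H) : F := counit h.

Lemma lin_eps (F : fieldType) (H : hopfAlgType F) (U : lmodType F) (f : U -> H) :
  lin f -> lin (fun x => eps (f x) : F^o).
Proof. exact: lin_hom. Qed.

Ltac lin_step := match goal with
  | |- forall _, _ => intro
  | |- lin (fun x => x) => exact: lin_id
  | |- lin (sw ?b) => apply: (@lin_sw_arg _ _ _ _ b id)
  | |- lin (fun x => sw ?b (@?f x)) => apply: (@lin_sw_arg _ _ _ _ b f)
  | |- lin (fun x => sw (@?b x) ?h) => apply: (@lin_sw _ _ _ _ b h)
  | |- lin (fun x => eps (@?f x)) => apply: (@lin_eps _ _ _ f)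
  | |- lin (fun x => @?f x *: ?c) => apply: (@lin_scalel _ _ _ f c)
  | |- lin (fun x => ?c *: @?f x) =>
    first [apply: (@lin_scaler _ _ _ f c) | apply: (@lin_fscaler _ _ f c)]
  | |- lin (fun x => @?f x *m ?c) => apply: (@lin_mulmxl _ _ _ _ _ f c)
  | |- lin (fun x => ?c *m @?f x) => apply: (@lin_mulmxr _ _ _ _ _ f c)
  | |- lin (fun x => @?f x * ?c) =>
    first [apply: (@lin_mull _ _ _ f c) | apply: (@lin_fmull _ _ f c)]
  | |- lin (fun x => ?c * @?f x) =>
    first [apply: (@lin_mulr _ _ _ f c) | apply: (@lin_fmulr _ _ f c)]
  | |- lin (fun x => coord ?X ?i (@?f x)) => apply: (@lin_coord _ _ _ _ X i f)
  | |- lin (fun x => \tr (@?f x)) => apply: (@lin_mxtrace _ _ _ f)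
  | |- lin (fun x => fun_of_lfun ?g (@?f x)) => apply: (@lin_hom _ _ _ _ g f)
  | |- lin (fun x => fun_of_matrix (@?f x) ?i ?j) =>
    apply: (@lin_mxE _ _ _ _ f i j)
  | |- lin (fun x => \sum_(i <- _) _) => apply: lin_sum
  | |- lin _ => progress cbn beta
  end.
Ltac lin := by repeat lin_step.

Section Sweedler.
Variables (F : fieldType) (H : hopfAlgType F).
Implicit Types (W : vectType F) (h g : H).

Lemma swE W (b : H -> H -> W) h :
  sw b h = \sum_i \sum_j comul h i j *: b (canb i) (canb j).
Proof. by []. Qed.

Lemma linsw W W' (f : W -> W') (b : H -> H -> W) h :
  lin f -> f (sw b h) = sw (fun p q => f (b p q)) h.
Proof.
move=> fl; rewrite !swE (linsum fl); apply: eq_bigr => i _.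
by rewrite (linsum fl); apply: eq_bigr => j _; rewrite linZ.
Qed.

Lemma sw_mull (b : H -> H -> H) h c :
  sw b h * c = sw (fun p q => b p q * c) h.
Proof. by apply: (linsw (f := fun x => x * c)); lin. Qed.

Lemma sw_mulr (b : H -> H -> H) h c :
  c * sw b h = sw (fun p q => c * b p q) h.
Proof. by apply: (linsw (f := fun x => c * x)); lin. Qed.

Lemma sw_scaler W (b : H -> H -> W) h (c : F) :
  c *: sw b h = sw (fun p q => c *: b p q) h.
Proof. by apply: (linsw (f := fun x => c *: x)); lin. Qed.

Lemma sw_mulmxl m n r (b : H -> H -> 'M[F]_(m, n)) h (c : 'M_(n, r)) :
  sw b h *m c = sw (fun p q => b p q *m c) h.
Proof. by apply: (linsw (f := fun x => x *m c)); lin. Qed.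

Lemma sw_mulmxr m n r (b : H -> H -> 'M[F]_(m, n)) h (c : 'M_(r, m)) :
  c *m sw b h = sw (fun p q => c *m b p q) h.
Proof. by apply: (linsw (f := fun x => c *m x)); lin. Qed.

Lemma sw_sum W I (r : seq I) (b : I -> H -> H -> W) h :
  sw (fun p q => \sum_(i <- r) b i p q) h = \sum_(i <- r) sw (b i) h.
Proof.
rewrite [RHS]exchange_big swE; apply: eq_bigr => i _.
rewrite [RHS]exchange_big; apply: eq_bigr => j _.
by rewrite scaler_sumr.
Qed.

Lemma sw_exchange W (b : H -> H -> H -> H -> W) h g :
  sw (fun p q => sw (fun r s => b p q r s) g) h =
  sw (fun r s => sw (fun p q => b p q r s) h) g.
Proof.
rewrite [RHS]swE [LHS]sw_sum; apply: eq_bigr => i _.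
rewrite sw_sum; apply: eq_bigr => j _.
by rewrite sw_scaler.
Qed.

(** Coassociativity is an equality in H (x) (H (x) H), and the linear map T that the trilinear t
    induces there carries it to this identity. *)
Lemma swA W (t : H -> H -> H -> W) h :
    (forall q r, lin (fun p => t p q r)) -> (forall p r, lin (fun q => t p q r)) ->
    (forall p q, lin (fun r => t p q r)) ->
  sw (fun p r => sw (fun c d => t c d r) p) h =
  sw (fun p r => sw (fun c d => t p c d) r) h.
Proof.
move=> t1 t2 t3.
pose T := tlift (fun (u : H) (s : tensor H H) => tlift (fun v w => t u v w) s).
have TL : lin T by exact: tlift_linear.
have TP u s : T (pten u s) = tlift (fun v w => t u v w) s.
  rewrite /T tlift_pten // => [y|x]; last exact: tlift_linear.
  apply: (@lin_sum _ _ _ _ _ (fun i u => \sum_j y i j *: t u (canb i) (canb j))).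
  by move=> i; apply: lin_sum => j; apply: lin_scaler.
have := congr1 T (comulA h); rewrite /tmap.
have AL : lin (@tassoc F H H H) by exact: tlift_linear.
have AP s w : tassoc (pten s w) = tlift (fun u v => pten u (pten v w)) s.
  rewrite /tassoc tlift_pten // => [y|x]; first exact: tlift_linear.
  apply: (@lin_sum _ _ _ _ _
    (fun i y => \sum_j x i j *: pten (canb i) (pten (canb j) y))).
  move=> i; apply: lin_sum => j; apply: lin_scaler.
  by move=> a u v; rewrite pten_linr pten_linr.
rewrite -!/(sw _ _).
rewrite (linsw _ _ AL) (linsw _ _ TL) (linsw _ _ TL) => E.
transitivity (sw (fun p q : H => T (tassoc (pten (comul p) q))) h).
  apply: eq_sw => p q; rewrite AP -/(sw _ _) (linsw _ _ TL); apply: eq_sw => a b.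
  by rewrite TP (tlift_pten _ _ (t2 a) (t3 a)).
by rewrite E; apply: eq_sw => p q; rewrite TP.
Qed.

Lemma eps1 : eps (1 : H) = 1.
Proof. exact: counit1. Qed.

Lemma epsM g h : eps (g * h) = eps g * eps h.
Proof. exact: counitM. Qed.

Lemma sw_counitl W (f : H -> W) h : lin f ->
  sw (fun p q => eps p *: f q) h = f h.
Proof.
move=> fl; rewrite -[in RHS](counitl h) -/(sw _ _) linsw //.
by apply: eq_sw => p q; rewrite linZ.
Qed.

Lemma sw_counitr W (f : H -> W) h : lin f ->
  sw (fun p q => eps q *: f p) h = f h.
Proof.
move=> fl; rewrite -[in RHS](counitr h) -/(sw _ _) linsw //.
by apply: eq_sw => p q; rewrite linZ.
Qed.

Lemma sw_antipodel h : sw (fun p q => antipode p * q) h = eps h *: 1.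
Proof. exact: antipodel. Qed.

Lemma sw_antipoder h : sw (fun p q => p * antipode q) h = eps h *: 1.
Proof. exact: antipoder. Qed.

Lemma sw1 W (b : H -> H -> W) :
    (forall q, lin (fun p => b p q)) -> (forall p, lin (b p)) ->
  sw b 1 = b 1 1.
Proof. by move=> b1 b2; rewrite /sw comul1 tlift_pten. Qed.

Lemma swM W (b : H -> H -> W) g h :
    (forall q, lin (fun p => b p q)) -> (forall p, lin (b p)) ->
  sw b (g * h) = sw (fun p q => sw (fun r s => b (p * r) (q * s)) h) g.
Proof.
move=> b1 b2; rewrite /sw comulM /tmul.
have bL : lin (tlift b) by exact: tlift_linear.
rewrite -!/(sw _ _) (linsw _ _ bL); apply: eq_sw => p q.
by rewrite -/(sw _ _) (linsw _ _ bL); apply: eq_sw => r s; rewrite tlift_pten.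
Qed.

Lemma antipode1 : antipode (1 : H) = 1.
Proof.
have := sw_antipodel 1; rewrite sw1 ?mulr1 ?eps1 ?scale1r //; lin.
Qed.

(* Both sides are S(g1 h1) g2 h2 S(h3) S(g3). *)
Lemma antipodeM g h : antipode (g * h) = antipode h * antipode g.
Proof.
pose t (p1 p2 q r1 r2 s : H) : H :=
  antipode (p1 * r1) * (p2 * r2) * (antipode s * antipode q).
transitivity (sw (fun p q : H => sw (fun p1 p2 : H =>
    sw (fun r s : H => sw (fun r1 r2 : H => t p1 p2 q r1 r2 s) r) h) p) g);
  last first.
  (* In this bracketing S(g1 h1) g2 h2 contracts by the antipode axiom for a product, which leaves
     S(h) S(g). *)
  transitivity (sw (fun p q : H => eps p *:
      sw (fun r s : H => eps r *: (antipode s * antipode q)) h) g).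
    apply: eq_sw => p q; rewrite sw_exchange sw_scaler; apply: eq_sw => r s.
    rewrite scalerA -[antipode s * _]mul1r scalerAl -epsM -sw_antipodel.
    rewrite swM; try lin.
    by rewrite sw_mull; apply: eq_sw => p1 p2; rewrite sw_mull.
  rewrite sw_counitl; last by lin.
  by rewrite sw_counitl //; lin.
transitivity (sw (fun p q : H => sw (fun p1 p2 : H =>
    sw (fun r s : H => sw (fun r1 r2 : H => t p p1 p2 r r1 r2) s) h) q) g);
  last first.
  rewrite -swA; try (rewrite /t; lin).
  apply: eq_sw => p q; apply: eq_sw => p1 p2; apply/esym/swA; rewrite /t; lin.
(* In the other bracketing h2 S(h3) contracts first and g2 S(g3) afterwards, which leaves S(g h). *)
have E p p1 p2 : sw (fun r s : H => sw (fun r1 r2 : H => t p p1 p2 r r1 r2) s) h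
    = antipode (p * h) * (p1 * antipode p2).
  rewrite -(sw_counitr (f := fun x => antipode (p * x) * (p1 * antipode p2)));
    last by lin.
  apply: eq_sw => r s.
  transitivity (antipode (p * r) * p1 * (eps s *: (1 : H) * antipode p2));
    last first.
    by rewrite -scalerAl mul1r -scalerAr mulrA.
  rewrite -sw_antipoder sw_mull sw_mulr; apply: eq_sw => r1 r2.
  by rewrite /t !mulrA.
rewrite -(sw_counitr (f := fun x => antipode (x * h))); last by lin.
apply: eq_sw => p q; rewrite -[antipode (p * h)]mulr1 scalerAr -sw_antipoder sw_mulr.
by apply: eq_sw => p1 p2; rewrite E.
Qed.

(* [x y1 (x) S(y2) = x1 y1 (x) S(x2 y2) x3] *)
Lemma sw_shift W (b : H -> H -> W) x y :
    (forall q, lin (fun p => b p q)) -> (forall p, lin (b p)) ->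
  sw (fun p q => b (x * p) (antipode q)) y =
  sw (fun c d => sw (fun p q => b p (antipode q * d)) (c * y)) x.
Proof.
move=> b1 b2.
have bl1 (U : lmodType F) (f : U -> H) q : lin f -> lin (fun p => b (f p) q).
  by move=> fl a u v; rewrite fl b1.
have bl2 (U : lmodType F) (f : U -> H) p : lin f -> lin (fun q => b p (f q)).
  by move=> fl a u v; rewrite fl b2.
(* By [antipodeM] the right side is b(x1 y1, S(y2) S(x2) x3), in which S(x2) x3 contracts. *)
transitivity (sw (fun c d : H => sw (fun c1 c2 : H => sw (fun p q : H =>
    b (c1 * p) (antipode q * (antipode c2 * d))) y) c) x); last first.
  apply: eq_sw => c d; rewrite swM; last 2 first.
  - by move=> q; apply: bl1; lin.
  - by move=> p; apply: bl2; lin.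
  apply: eq_sw => c1 c2; apply: eq_sw => p q.
  by rewrite antipodeM mulrA.
rewrite swA; last 3 first.
- by move=> *; apply: lin_sw => *; apply: bl1; lin.
- by move=> *; apply: lin_sw => *; apply: bl2; lin.
- by move=> *; apply: lin_sw => *; apply: bl2; lin.
rewrite -(sw_counitr (f := fun x => sw (fun p q => b (x * p) (antipode q)) y));
  last by apply: lin_sw => *; apply: bl1; lin.
apply: eq_sw => p r; rewrite sw_scaler sw_exchange; apply: eq_sw => p1 q1.
rewrite -(linsw (f := fun x => b (p * p1) (antipode q1 * x))); 
  last by apply: (bl2 _ (fun x => antipode q1 * x)); lin.
by rewrite sw_antipodel -scalerAr mulr1 (linZ (b2 _)).
Qed.

End Sweedler.

(** * Integrals of Hopf subalgebras *)

Lemma span_ind (F : fieldType) (V : vectType F) (X : seq V) (P : V -> Prop) :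
    P 0 -> (forall a u v, P u -> P v -> P (a *: u + v)) ->
    (forall x, x \in X -> P x) ->
  forall v, v \in <<X>>%VS -> P v.
Proof.
move=> P0 PD PX v /(@coord_span _ _ _ (in_tuple X)) ->.
elim/big_rec: _ => // i u _ Pu; apply: PD => //.
by apply/PX/mem_nth.
Qed.

Section HopfSubalgebra.
Variables (F : fieldType) (H : hopfAlgType F) (K : {aspace H}).
Hypothesis hopfK : hopf_subalgebra K.
Implicit Types (W : vectType F) (x y t : H).

Lemma hopf_mem1 : 1 \in K.
Proof. by case: hopfK. Qed.

Lemma hopf_memS x : x \in K -> antipode x \in K.
Proof. by case: hopfK => _ _ /subvP S Kx; apply/S/memv_img. Qed.

(** As [comul] maps K into the span of the p (x) q with p, q in K, the Sweedler components of x may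
    be taken in K, although [sw] is computed in a basis of H. *)
Lemma sw_ind W (b : H -> H -> W) (P : W -> Prop) x :
    (forall q, lin (fun p => b p q)) -> (forall p, lin (b p)) ->
    P 0 -> (forall a u v, P u -> P v -> P (a *: u + v)) ->
    {in K &, forall p q, P (b p q)} -> x \in K ->
  P (sw b x).
Proof.
move=> b1 b2 P0 PD PK Kx.
have : comul x \in tensv K K.
  by case: hopfK => _ /subvP D _; apply/D/memv_img.
rewrite /sw; apply: (@span_ind _ _ _ (fun s => P (tlift b s))).
- by rewrite (lin0 (@tlift_linear _ _ _ _ b)).
- by move=> a u v Pu Pv; rewrite tlift_linear; apply: PD.
move=> _ /allpairsP[[p q] /= [Kp Kq ->]]; rewrite (tlift_pten _ _ b1 b2).
by apply: PK; apply: vbasis_mem.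
Qed.

Lemma sw_mem W (b : H -> H -> W) (U : {vspace W}) x :
    (forall q, lin (fun p => b p q)) -> (forall p, lin (b p)) ->
    {in K &, forall p q, b p q \in U} -> x \in K ->
  sw b x \in U.
Proof.
move=> b1 b2 bU; apply: (@sw_ind _ _ (fun u => u \in U)) => //; first exact: mem0v.
by move=> a u v Uu Uv; rewrite memvD // memvZ.
Qed.

Lemma eq_sw_in W (b c : H -> H -> W) x :
    (forall q, lin (fun p => b p q)) -> (forall p, lin (b p)) ->
    (forall q, lin (fun p => c p q)) -> (forall p, lin (c p)) ->
    {in K &, forall p q, b p q = c p q} -> x \in K ->
  sw b x = sw c x.
Proof.
move=> b1 b2 c1 c2 bc Kx.
suff : sw (fun p q => (b p q - c p q : W)) x \in 0%VS.
  rewrite memv0 => /eqP E; apply/eqP; rewrite -subr_eq0 -E; apply/eqP.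
  rewrite !swE -sumrB; apply: eq_bigr => i _; rewrite -sumrB.
  by apply: eq_bigr => j _; rewrite scalerBr.
apply: sw_mem => // [q a u v|p a u v|p q Kp Kq].
- by rewrite b1 c1 scalerBr opprD addrACA.
- by rewrite b2 c2 scalerBr opprD addrACA.
by rewrite bc // subrr mem0v.
Qed.

Definition left_integral t := t \in K /\ {in K, forall x, x * t = eps x *: t}.

Let e (i : 'I_(\dim K)) : H := (vbasis K)`_i.
Local Notation ec i := (coord (vbasis K) i).

Let Ke i : e i \in K.
Proof. by apply/vbasis_mem/mem_nth; rewrite size_tuple. Qed.

Let eK x : x \in K -> x = \sum_i ec i x *: e i.
Proof. exact: coord_vbasis. Qed.

Let ecM i y z : z \in K -> ec i (y * z) = \sum_j ec i (y * e j) * ec j z.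
Proof.
move=> Kz; rewrite {1}(eK Kz) mulr_sumr linear_sum; apply: eq_bigr => j _ /=.
by rewrite -scalerAr linearZ mulrC.
Qed.

(* The canonical element of [K (x) K^*] is invariant for the diagonal action; *)
(* transported by the isomorphism [a (x) f |-> a1 (x) f (S^2(a2) _)] from the *)
(* diagonal action to the action on the first factor, its values are          *)
(* integrals.                                                                 *)
Definition integral_of m : H :=
  \sum_(i < \dim K) sw (fun p q => ec i (antipode (antipode q) * m) *: p) (e i).

Lemma integral_ofP m : m \in K -> left_integral (integral_of m).
Proof.
move=> Km; split=> [|x Kx].
  apply: memv_suml => i _; apply: sw_mem; try lin.
  by move=> p q Kp _; rewrite memvZ.
pose R z := \sum_(i < \dim K)
  sw (fun p q => ec i (antipode (antipode q) * m) *: p) (z * e i).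
have RL : lin R by apply: lin_sum => i; lin.
have R1 : R 1 = integral_of m by apply: eq_bigr => i _; rewrite mul1r.
(* The right side becomes R(x1 S(x2)), and [sw_shift] spreads x over the left side in the same way,
   so that both are sums over the components c, d of x. *)
rewrite -R1 -(linZ RL) -sw_antipoder (linsw _ _ RL) R1.
rewrite /integral_of mulr_sumr.
under eq_bigr => i _.
  rewrite sw_mulr.
  under eq_sw => p q do rewrite -scalerAr.
  rewrite (sw_shift (b := fun p q => ec i (antipode q * m) *: p)); try lin.
  over.
rewrite -sw_sum; apply: eq_sw_in => //; try (rewrite /R; lin).
move=> c d Kc Kd.
(* By [ecM], S(d) S^2(q) m is expanded along the e_j; the sum over i then reassembles S(d) e_j,
   which gives R(c S(d)). *)
transitivity (\sum_(i < \dim K) \sum_(j < \dim K) ec i (antipode d * e j) *: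
   sw (fun p q => ec j (antipode (antipode q) * m) *: p) (c * e i)).
  apply: eq_bigr => i _.
  under [RHS]eq_bigr => j _ do rewrite sw_scaler.
  rewrite -sw_sum; apply: eq_sw_in; try lin; last by rewrite memvM ?Ke.
  move=> p q Kp Kq; under [RHS]eq_bigr => j _ do rewrite scalerA.
  rewrite -scaler_suml; congr (_ *: p).
  by rewrite antipodeM -mulrA ecM // memvM // !hopf_memS.
rewrite exchange_big /=; apply: eq_bigr => j _.
rewrite -mulrA [in RHS](eK (x := antipode d * e j)); last first.
  by rewrite memvM ?hopf_memS ?Ke.
rewrite mulr_sumr (linsum (f := sw _)); last by lin.
by apply: eq_bigr => i _; rewrite -scalerAr (linZ (f := sw _)) //; lin.
Qed.

(** The isomorphism behind [integral_of] can be undone: 1 is recovered linearly from the integrals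
    [integral_of] e_j, so these cannot all vanish. *)
Lemma left_integral_neq0 : exists2 t, t != 0 & left_integral t.
Proof.
have [//|noQ] := pselect (exists2 t, t != 0 & left_integral t).
have Q0 m : m \in K -> integral_of m = 0.
  move=> Km; apply/eqP/negP => /negP Q; case: noQ.
  by exists (integral_of m) => //; apply: integral_ofP.
have K1 := hopf_mem1.
suff : 1 = 0 :> H by move/eqP; rewrite oner_eq0.
(* Z is the sum of the e_i1 e^i(S^2(e_i3) S(e_i2)), where S^2(e_i3) S(e_i2) = S(e_i2 S(e_i3))
   contracts; what remains is the sum of the e^i(1) e_i, which is 1. *)
pose Z := \sum_(i < \dim K) sw (fun a b => sw (fun p q =>
   ec i (antipode (antipode b) * antipode q) *: p) a) (e i).
transitivity Z.
  rewrite [LHS]eK //; apply: eq_bigr => i _.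
  rewrite swA; try lin.
  rewrite -(sw_counitr (f := fun p => ec i 1 *: p)); last by lin.
  apply: eq_sw => p r.
  rewrite -(linsw (f := fun x : F^o => (x : F) *: p)); last by lin.
  rewrite scalerA; congr (_ *: p).
  under eq_sw => c d do rewrite -antipodeM.
  rewrite -(linsw (f := fun x => ec i (antipode x) : F^o)); last by lin.
  by rewrite sw_antipoder linearZ /= antipode1 linearZ.
pose Y j a := sw (fun p q => ec j (antipode q) *: p) a.
transitivity (\sum_(j < \dim K) Y j (integral_of (e j))); last first.
  apply: big1 => j _; rewrite Q0 ?Ke // /Y.
  by rewrite (lin0 (f := sw _)) //; lin.
under [RHS]eq_bigr => j _.
  rewrite /integral_of (linsum (f := Y j)); last by rewrite /Y; lin.
  over.
rewrite exchange_big /=; apply: eq_bigr => i _.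
under [RHS]eq_bigr => j _.
  rewrite (linsw (f := Y j)); last by rewrite /Y; lin.
  over.
rewrite -sw_sum; apply: eq_sw_in; try (rewrite /Y; lin).
move=> a b Ka Kb.
rewrite /Y; under [RHS]eq_bigr => j _.
  rewrite (linZ (f := sw _)); last by lin.
  rewrite sw_scaler.
  over.
rewrite -sw_sum; apply: eq_sw_in; try lin.
move=> p q Kp Kq; under eq_bigr => j _ do rewrite scalerA.
rewrite -scaler_suml; congr (_ *: p).
by rewrite ecM ?hopf_memS.
Qed.

End HopfSubalgebra.

Lemma sw_zero (F : fieldType) (H : hopfAlgType F) (W : vectType F)
    (b : H -> H -> W) h : (forall p q, b p q = 0) -> sw b h = 0.
Proof.
by move=> b0; apply: big1 => i _; apply: big1 => j _; rewrite b0 scaler0.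
Qed.

(** * Normal Hopf subalgebras *)

Section NormalSubalgebra.
Variables (F : fieldType) (H : hopfAlgType F) (K : {aspace H}).
Hypotheses (hopfK : hopf_subalgebra K) (normK : hopf_normal K).
Implicit Types (x g t : H).

(** The right adjoint action of H, under which K is stable by normality. *)
Definition adr x g : H := sw (fun c d => antipode c * x * d) g.

Lemma adr_mem x g : x \in K -> adr x g \in K.
Proof. by move=> Kx; case: (normK g Kx). Qed.

Lemma eps_adr x g : eps x = 0 -> eps (adr x g) = 0.
Proof.
move=> x0; rewrite /adr [LHS](linsw (f := fun x : H => eps x : F^o)); last by lin.
by rewrite sw_zero // => c d; rewrite !epsM x0 mulr0 mul0r.
Qed.

(** In g1 S(g2) x g3 the first two factors contract. This moves elements of K to the right past
    g. *)
Lemma mul_adr x g : x * g = sw (fun a b => a * adr x b) g.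
Proof.
under eq_sw => a b do rewrite /adr sw_mulr.
rewrite -swA; try lin.
rewrite -[LHS](sw_counitl (f := fun r => x * r)); last by lin.
apply: eq_sw => p r; rewrite -[x * r]mul1r scalerAl -sw_antipoder sw_mull.
by apply: eq_sw => c d; rewrite !mulrA.
Qed.

Lemma augP x : reflect (x \in K /\ eps x = 0) (x \in aug K).
Proof.
by rewrite memv_cap memv_ker; apply: (iffP andP) => -[Kx /eqP ex]; split=> //;
  apply/eqP.
Qed.

Lemma aug_mulr x g : x \in aug K -> x * g \in ({:H} * aug K)%VS.
Proof.
move=> /augP[Kx ex]; rewrite mul_adr.
apply: memv_suml => i _; apply: memv_suml => j _; apply/memvZ/memv_mul.
  exact: memvf.
by apply/augP; rewrite adr_mem ?eps_adr.
Qed.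

(** By [aug_mulr], K^+ H lies in H K^+, so this left ideal is two-sided. *)
Lemma haug_mulr u g :
  u \in ({:H} * aug K)%VS -> u * g \in ({:H} * aug K)%VS.
Proof.
have augH : (aug K * {:H} <= {:H} * aug K)%VS.
  by apply/prodvP => x h Kx _; apply: aug_mulr.
move=> uHK; have: u * g \in ({:H} * aug K * {:H})%VS by rewrite memv_mul ?memvf.
apply/subvP; rewrite -prodvA; apply: subv_trans (prodvSr _ augH) _.
by rewrite prodvA prodvSl ?subvf.
Qed.

Lemma eps_integral_neq0 t :
  semisimple_alg H -> left_integral K t -> t != 0 -> eps t != 0.
Proof.
move=> ssH [Kt intt] t0; apply: contra_neq t0 => et0.
have tgt g : t * g * t = 0.
  rewrite [t * g]mul_adr sw_mull; apply: sw_zero => a b.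
  by rewrite -mulrA intt ?adr_mem // eps_adr // scale0r mulr0.
have idealI : left_ideal (limg (amulr t)).
  apply/prodvP => u _ _ /memv_imgP[v _ ->]; rewrite lfunE /= mulrA.
  by apply/memv_imgP; exists (u * v); rewrite ?memvf // lfunE.
have [J [idealJ IJ IJ0]] := ssH _ idealI.
(* Write 1 = a + c along H t and its complement J. As a a = 0, a = a c lies in J, so a = 0; then 1
   is in J, and so is t. *)
have [a Ia [c Jc ac]] : exists2 a, a \in limg (amulr t)
    & exists2 c, c \in J & 1 = a + c.
  by apply/memv_addP; rewrite IJ memvf.
have memJ u v : v \in J -> u * v \in J.
  by move=> Jv; apply: (subvP idealJ); rewrite memv_mul ?memvf.
have a0 : a = 0.
  apply/eqP; rewrite -memv0 -IJ0 memv_cap Ia /=.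
  have aa : a * a = 0.
    case/memv_imgP: Ia => h _ ->; rewrite lfunE /=.
    by rewrite -mulrA [t * _]mulrA tgt mulr0.
  by rewrite -[a]mulr1 ac mulrDr aa add0r memJ.
have J1 : 1 \in J by rewrite ac a0 add0r.
apply/eqP; rewrite -memv0 -IJ0 memv_cap -{3}[t]mulr1 memJ // andbT.
by apply/memv_imgP; exists 1; rewrite ?memvf // lfunE /= mul1r.
Qed.

Lemma normalized_integral : semisimple_alg H ->
  exists2 t, left_integral K t & eps t = 1.
Proof.
move=> ssH; have [t t0 tP] := left_integral_neq0 hopfK.
have et0 := eps_integral_neq0 ssH tP t0; case: tP => Kt intt.
have eZ a x : eps (a *: x) = a * eps x by rewrite /eps linearZ.
exists ((eps t)^-1 *: t); last by rewrite eZ mulVf.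
split=> [|x Kx]; first by rewrite memvZ.
by rewrite -scalerAr intt // !scalerA mulrC.
Qed.

End NormalSubalgebra.

(** * Averaging over a normalized integral *)

(** In a full rank factorization P = C R, cancelling C on the left and R on the right of C R C R = C
    R gives R C = 1, and P has the trace of R C. *)
Lemma mxtrace_idem (F : fieldType) n (P : 'M[F]_n) :
  P *m P = P -> \tr P = (\rank P)%:R.
Proof.
move=> PP; rewrite -{1}[P]mulmx_base mxtrace_mulC.
suff -> : row_base P *m col_base P = 1%:M by rewrite mxtrace1.
have CR : col_base P *m row_base P *m (col_base P *m row_base P) =
  col_base P *m row_base P by rewrite mulmx_base.
have [C' C'C] : exists C', C' *m col_base P = 1%:M.
  by exists (pinvmx (col_base P)); rewrite mulVpmx ?col_base_full.
have [R' RR'] : exists R', row_base P *m R' = 1%:M.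
  by exists (pinvmx (row_base P)); rewrite mulmxVp ?row_base_free.
move: (col_base P) (row_base P) CR C'C RR' => C R CR C'C RR'.
have := congr1 (fun X => C' *m X *m R') CR.
by rewrite /= !mulmxA C'C !mul1mx -mulmxA RR' mulmx1.
Qed.

Lemma mulmx_delta_mulmxE (F : fieldType) m n r s
    (M : 'M[F]_(r, m)) (N : 'M[F]_(n, s)) i j k l :
  (M *m delta_mx i k *m N) j l = M j i * N k l.
Proof.
have E h : (M *m delta_mx i k) j h = M j i * (h == k)%:R.
  rewrite mxE (bigD1 i) //= big1 => [|c /negPf ci]; rewrite !mxE ?eqxx ?addr0 //.
  by rewrite ci mulr0.
rewrite mxE (bigD1 k) //= big1 => [|h /negPf hk]; rewrite E ?eqxx ?mulr1 ?addr0 //.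
by rewrite hk mulr0 mul0r.
Qed.

Section ExtendedAction.
Variables (F : fieldType) (H : hopfAlgType F) (K : {aspace H}).
Hypothesis hopfK : hopf_subalgebra K.
Implicit Types A : Defs.repr (subvs_of K).

(* The action of K, extended linearly to H; it is multiplicative only on K. *)
Definition subr A (h : H) : 'M[F]_(rdeg A) := A (vsproj K h).

Lemma subrE A (a : subvs_of K) : A a = subr A (vsval a).
Proof. by rewrite /subr vsvalK. Qed.

Lemma subr1 A : subr A 1 = 1%:M.
Proof.
rewrite -(rmat1 A) subrE; congr (subr A _).
by apply/esym/eqP; rewrite algid_eq1 hopf_mem1.
Qed.

Lemma subrM A : {in K &, forall x y, subr A (x * y) = subr A x *m subr A y}.
Proof.
move=> x y Kx Ky; rewrite -rmatM /subr; congr (A _).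
by apply: val_inj; rewrite /= !vsprojK ?memvM.
Qed.

Lemma lin_subr A (U : lmodType F) (f : U -> H) :
  lin f -> lin (fun u => subr A (f u)).
Proof. by move=> fl a u v; rewrite fl /subr !linearP. Qed.

End ExtendedAction.

Ltac lin_step' := match goal with
  | |- lin (fun x => subr ?A (@?f x)) => apply: (@lin_subr _ _ _ A _ f)
  | |- _ => lin_step
  end.
Ltac lin ::= by repeat lin_step'.

Section Averaging.
Variables (F : fieldType) (H : hopfAlgType F) (K : {aspace H}).
Hypothesis hopfK : hopf_subalgebra K.
Variable t : H.
Hypotheses (tP : left_integral K t) (et : eps t = 1).
Implicit Types A B : Defs.repr (subvs_of K).

(** By [sw_shift] the left side is computed on x1 t instead of t, with x2 multiplied into the second
    argument; x1 t = eps(x1) t then leaves x there. *)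
Lemma casimir (W : vectType F) (b : H -> H -> W) x :
    (forall q, lin (fun p => b p q)) -> (forall p, lin (b p)) -> x \in K ->
  sw (fun p q => b (x * p) (antipode q)) t =
  sw (fun p q => b p (antipode q * x)) t.
Proof.
move=> b1 b2 Kx.
have bl (U : lmodType F) (f : U -> H) p : lin f -> lin (fun q => b p (f q)).
  by move=> fl a u v; rewrite fl b2.
have fl : lin (fun d => sw (fun p q => b p (antipode q * d)) t).
  by apply: lin_sw => p q; apply: (bl _ (fun d => antipode q * d)); lin.
rewrite sw_shift // -(sw_counitl x fl); apply: (eq_sw_in hopfK) => //.
- lin.
- by move=> c; apply: lin_sw => p q; apply: (bl _ (fun d => antipode q * d)); lin.
- lin.
- by move=> c; apply: lin_scaler.
move=> c d Kc Kd; rewrite (proj2 tP) // (linZ (f := sw _)) //; lin.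
Qed.

Definition avg A B (X : 'M[F]_(rdeg B, rdeg A)) : 'M[F]_(rdeg B, rdeg A) :=
  sw (fun p q => subr B p *m X *m subr A (antipode q)) t.

Lemma lin_avg A B : lin (@avg A B).
Proof. by apply: lin_sw => p q; lin. Qed.

Lemma rhomP A B X :
  X \in rhom A B <-> {in K, forall x, X *m subr A x = subr B x *m X}.
Proof.
split=> [/mem_rhom XP x Kx|XP]; first exact: XP.
by apply/mem_rhom => a; rewrite !subrE XP ?subvsP.
Qed.

Lemma avg_hom A B X : avg X \in rhom A B.
Proof.
have Kt := proj1 tP; apply/rhomP => x Kx; apply/esym; rewrite sw_mulmxl sw_mulmxr.
transitivity (sw (fun p q => subr B (x * p) *m X *m subr A (antipode q)) t).
  apply: (eq_sw_in hopfK) => //; try lin.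
  by move=> p q Kp Kq; rewrite subrM // !mulmxA.
rewrite (casimir (b := fun p q => subr B p *m X *m subr A q)) //; try lin.
apply: (eq_sw_in hopfK) => //; try lin.
by move=> p q Kp Kq; rewrite subrM ?hopf_memS // !mulmxA.
Qed.

Lemma avg_mulr A A' B (X : 'M_(_, _)) Y :
  X \in rhom A A' -> @avg A' B Y *m X = avg (Y *m X).
Proof.
move=> /rhomP XP; rewrite sw_mulmxl; apply: (eq_sw_in hopfK); try lin.
  by move=> p q Kp Kq; rewrite -!mulmxA XP ?hopf_memS.
exact: (proj1 tP).
Qed.

Lemma sw_subr_antipoder A x :
  x \in K -> sw (fun p q => subr A p *m subr A (antipode q)) x = (eps x)%:M.
Proof.
move=> Kx; transitivity (subr A (sw (fun p q => p * antipode q) x)).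
  rewrite (linsw (f := subr A)); last by apply: lin_subr.
  apply: (eq_sw_in hopfK) => //; try lin.
  by move=> p q Kp Kq; rewrite subrM ?hopf_memS.
rewrite sw_antipoder (linZ (f := subr A)); last by apply: lin_subr.
by rewrite (subr1 hopfK) scalemx1.
Qed.

Lemma avg1 A : avg (1%:M : 'M_(rdeg A)) = 1%:M.
Proof.
rewrite /avg; under eq_sw => p q do rewrite mulmx1.
by rewrite sw_subr_antipoder ?et //; case: tP.
Qed.

Lemma avg_id A B X : X \in rhom A B -> avg X = X.
Proof.
move=> /rhomP XP; rewrite -[RHS]mulmx1 -avg1 sw_mulmxr.
apply: (eq_sw_in hopfK); try lin; last exact: (proj1 tP).
by move=> p q Kp Kq; rewrite mulmx1 mulmxA XP.
Qed.

(** On the characters of A and B this is dim Hom_K(A, B), as an element of F. *)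
Definition char_pairing (f g : dual (subvs_of K)) : F^o :=
  sw (fun p q => g (vsproj K p) * f (vsproj K (antipode q)) : F^o) t.

(** The trace is taken over the matrix units E_ij: the (i, j) entry of B(t1) E_ij A(S(t2)) is a
    product of diagonal entries, and the sum over i and j is a product of traces. *)
Lemma mxtrace_avg A B :
  \tr (lin_mx (@avg A B)) = char_pairing (rchar A) (rchar B).
Proof.
transitivity (\sum_i \sum_j avg (delta_mx i j : 'M_(rdeg B, rdeg A)) i j).
  rewrite /mxtrace (reindex _ (curry_mxvec_bij _ _)) /= pair_bigA /=.
  apply: eq_bigr => -[i j] _ /=.
  by rewrite mxE /= vec_mx_delta mxvecE.
rewrite /char_pairing.
transitivity (sw (fun p q => \sum_i \sum_j
   (subr B p *m delta_mx i j *m subr A (antipode q)) i j : F^o) t).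
  rewrite sw_sum; apply: eq_bigr => i _; rewrite sw_sum; apply: eq_bigr => j _.
  by apply: (linsw (f := fun M : 'M[F]_(rdeg B, rdeg A) => M i j : F^o)); lin.
apply: (@eq_sw F H (F^o : vectType F)) => p q.
rewrite !rcharE /mxtrace mulr_suml; apply: eq_bigr => i _.
rewrite mulr_sumr; apply: eq_bigr => j _.
exact: mulmx_delta_mulmxE.
Qed.

Hypothesis char0 : forall n, (n%:R == 0 :> F) = (n == 0)%N.

(** [avg] is a projection onto [rhom A B], so its trace is the dimension, and in characteristic 0
    this vanishes only for the zero space. Hence a module may be replaced by any other with the same
    character. *)
Lemma rhom_gt0 A B :
  (0 < \dim (rhom A B))%N = (char_pairing (rchar A) (rchar B) != 0).
Proof.
pose f : {linear _ -> _} := HB.pack (@avg A B)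
  (GRing.isLinear.Build _ _ _ _ _ (@lin_avg A B)).
have PE u : u *m lin_mx f = mxvec (avg (vec_mx u)) by rewrite mul_rV_lin.
have PP : lin_mx f *m lin_mx f = lin_mx f.
  apply/row_matrixP => i; rewrite row_mul !rowE !PE mxvecK.
  by congr mxvec; apply/avg_id/avg_hom.
rewrite -mxtrace_avg -[lin_mx _]/(lin_mx f) mxtrace_idem // char0 mxrank_eq0.
rewrite lt0n dimv_eq0; congr (~~ _); apply/eqP/eqP => [rhom0|P0].
  apply/row_matrixP => i; rewrite rowE PE row0.
  by apply/eqP; rewrite mxvec_eq0 -memv0 -rhom0 avg_hom.
apply/eqP; rewrite -subv0; apply/subvP => X rX.
have := PE (mxvec X); rewrite P0 mulmx0 mxvecK avg_id // => /esym/eqP.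
by rewrite mxvec_eq0 memv0.
Qed.

End Averaging.

(** * Modules and their coefficients *)

Lemma linfunE (F : fieldType) (U V : vectType F) (f : U -> V) :
  lin f -> linfun f =1 f.
Proof.
move=> fl.
pose g : {linear U -> V} := HB.pack f (GRing.isLinear.Build _ _ _ _ _ fl).
exact: (lfunE g).
Qed.

Lemma eq_colP (F : fieldType) m n (M N : 'M[F]_(m, n)) :
  (forall j, col j M = col j N) -> M = N.
Proof.
by move=> e; apply: trmx_inj; apply/row_matrixP => j; rewrite -!tr_col e.
Qed.

Section Representations.
Variables (F : fieldType) (A : falgType F).
Implicit Types V W S : Defs.repr A.

Section Subrepresentation.
Variables (V : Defs.repr A) (d : nat).
Variables (B : 'M[F]_(rdeg V, d)) (B' : 'M[F]_(d, rdeg V)).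
Hypotheses (B'B : B' *m B = 1%:M) (VB : forall a, V a *m B = B *m (B' *m V a *m B)).

Let f (a : A) := B' *m V a *m B.

Let fE : linfun f =1 f.
Proof. by apply: linfunE; rewrite /f; lin. Qed.

Let f1 : linfun f 1 = 1%:M.
Proof. by rewrite fE /f rmat1 mulmx1. Qed.

Let fM a b : linfun f (a * b) = linfun f a *m linfun f b.
Proof. by rewrite !fE /f rmatM mulmxA -[LHS]mulmxA VB !mulmxA. Qed.

(** The submodule spanned by the columns of B, in the coordinates given by the left inverse B'. *)
Definition subrepr : Defs.repr A := Repr f1 fM.

Lemma subreprE a : subrepr a = B' *m V a *m B.
Proof. exact: fE. Qed.

End Subrepresentation.

(** A nonzero submodule U of least dimension is simple. The columns of B are a basis of U, and B'
    takes coordinates in this basis. *)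
Lemma simple_submodule V : (0 < rdeg V)%N ->
  exists S (B : 'M_(rdeg V, rdeg S)) (B' : 'M_(rdeg S, rdeg V)),
    [/\ simple_repr S, B' *m B = 1%:M & forall a, V a *m B = B *m S a].
Proof.
move=> V0.
pose P n := `[< exists U : {vspace 'cV[F]_(rdeg V)},
   [/\ submodule U, U != 0%VS & \dim U = n] >].
have exP : exists n, P n.
  exists (\dim {:'cV[F]_(rdeg V)}); apply/asboolP; exists fullv; split=> //.
    by move=> a v _; rewrite memvf.
  by rewrite -dimv_eq0 dimvf /dim /= muln1 -lt0n.
case: (ex_minnP exP) => _ /asboolP[U [subU U0 <-]] minU.
pose b := vbasis U; pose d := \dim U.
pose B : 'M[F]_(rdeg V, d) := \matrix_(i, j) b`_j i 0.
pose B' : 'M[F]_(d, rdeg V) := \matrix_(i, j) coord b i (delta_mx j 0).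
have B'E (v : 'cV_(rdeg V)) i : (B' *m v) i 0 = coord b i v.
  rewrite mxE [in RHS](matrix_sum_delta v) linear_sum; apply: eq_bigr => j _.
  by rewrite big_ord1 linearZ mxE mulrC.
have BE u : B *m u = \sum_i u i 0 *: b`_i.
  apply/colP => i; rewrite mxE summxE; apply: eq_bigr => j _.
  by rewrite !mxE mulrC.
have colB j : col j B = b`_j by apply/colP => i; rewrite !mxE.
have B'B : B' *m B = 1%:M.
  apply: eq_colP => j; apply/colP => i.
  rewrite !colE -mulmxA -colE colB B'E mul1mx coord_free ?mxE ?eqxx ?andbT //.
    by rewrite eq_sym.
  exact: basis_free (vbasisP U).
have BB' u : u \in U -> B *m (B' *m u) = u.
  move=> Uu; rewrite BE [RHS](coord_vbasis Uu); apply: eq_bigr => i _.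
  by rewrite B'E.
have VB a : V a *m B = B *m (B' *m V a *m B).
  apply: eq_colP => j.
  rewrite !colE -!mulmxA -!colE colB BB' // subU //.
  by apply/vbasis_mem/mem_nth; rewrite size_tuple.
exists (subrepr B'B VB), B, B'; split=> // [|a]; last by rewrite subreprE VB.
split=> [|U' subU']; first by rewrite lt0n dimv_eq0.
have [->|U'0] := eqVneq U' 0%VS; [by left | right].
(* f carries U' to a nonzero submodule of V, whose dimension is at least that of U by minimality and
   at most that of U'. *)
pose f := linfun (fun u : 'cV[F]_d => B *m u).
have fE u : f u = B *m u by rewrite linfunE //; lin.
have subfU : submodule (f @: U')%VS.
  move=> a _ /memv_imgP[u U'u ->]; apply/memv_imgP.
  exists (subrepr B'B VB a *m u); first exact: subU'.
  by rewrite !fE subreprE mulmxA VB -!mulmxA.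
have fU0 : (f @: U' != 0)%VS.
  apply: contraNneq U'0 => fU0; rewrite -subv0; apply/subvP => u U'u.
  have : f u \in 0%VS by rewrite -fU0 memv_img.
  rewrite !memv0 fE => /eqP Bu0.
  by rewrite -[u]mul1mx -B'B -mulmxA Bu0 mulmx0.
apply/eqP; rewrite eqEdim subvf /= dimvf /dim /= muln1.
rewrite -(limg_ker_dim f U'); apply: leq_trans (leq_addl _ _).
apply: minU; apply/asboolP.
by exists (f @: U')%VS.
Qed.

(** The kernel of X is a submodule other than S, hence zero, and an injective matrix has a left
    inverse. *)
Lemma simple_mono S W (X : 'M[F]_(rdeg W, rdeg S)) :
    simple_repr S -> (forall a, X *m S a = W a *m X) -> X != 0 ->
  exists Y : 'M_(rdeg S, rdeg W), Y *m X = 1%:M.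
Proof.
move=> [S0 simS] XS X0; pose U := lker (linfun (fun u : 'cV_(rdeg S) => X *m u)).
have UE u : (u \in U) = (X *m u == 0) by rewrite memv_ker linfunE //; lin.
have subU : submodule U.
  by move=> a u; rewrite !UE mulmxA XS -mulmxA => /eqP ->; rewrite mulmx0.
case: (simS U subU) => [U0|UT]; last first.
  case/eqP: X0; apply/matrixP => i j.
  have := memvf (delta_mx j 0 : 'cV[F]_(rdeg S)).
  rewrite -UT UE -colE => /eqP/colP/(_ i).
  by rewrite !mxE.
suff : row_free X^T.
  move/mulmxVp/(congr1 trmx); rewrite trmx_mul trmxK trmx1.
  by exists (pinvmx X^T)^T.
rewrite -kermx_eq0; apply/eqP/row_matrixP => i; rewrite row0; apply: trmx_inj.
rewrite trmx0; apply/eqP; rewrite -memv0 -U0 UE -{1}[X]trmxK -trmx_mul.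
by rewrite -row_mul mulmx_ker row0 trmx0.
Qed.

Lemma rcoef_mem V (i j : 'I_(rdeg V)) : rcoef i j \in coef_space V.
Proof. by apply/memv_span/allpairs_f; rewrite mem_enum. Qed.

Lemma coef_spaceP W f : f \in coef_space W ->
  exists M : 'M_(rdeg W), forall a, f a = \tr (M *m W a).
Proof.
pose P (g : dual A) := exists M : 'M_(rdeg W), forall a, g a = \tr (M *m W a).
apply: (@span_ind _ _ _ P) => [|c u v [M uE] [N vE]|_ /allpairsP[[i j] [_ _ ->]]].
- by exists 0 => a; rewrite lfunE mul0mx mxtrace0.
- exists (c *: M + N) => a.
  by rewrite !lfunE /= lfunE /= uE vE mulmxDl -scalemxAl linearP.
exists (delta_mx j i) => a; rewrite rcoefE mxtrace_mulC /mxtrace.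
rewrite (bigD1 i) //= big1 => [|k /negPf ki]; rewrite mxE.
  rewrite (bigD1 j) //= big1 => [|k /negPf kj]; rewrite !mxE ?eqxx ?mulr1 ?addr0 //.
  by rewrite kj mulr0.
by rewrite big1 // => l _; rewrite mxE ki andbF mulr0.
Qed.

(** Irreducibility of chi makes the set under [xget] nonempty, so the default 0 is not taken and a
    simple module stands behind the chosen space. *)
Lemma simple_coalgP chi : Irr chi -> exists V,
  [/\ simple_repr V, rchar V = chi & simple_coalg chi = coef_space V].
Proof.
move=> [V [simV VE]]; apply: (@xgetPex _ 0%VS [set C | exists V : Defs.repr A,
       [/\ simple_repr V, rchar V = chi & C = coef_space V]]%classic).
by exists (coef_space V); exists V.
Qed.

End Representations.

(** * The two sides of the equivalence *)

Section Convolution.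
Variables (F : fieldType) (H : hopfAlgType F).
Implicit Types (f g : dual H) (A B : {vspace dual H}).

Lemma conv_swE f g h : conv f g h = sw (fun p q => f p * g q : F^o) h.
Proof. exact: convE. Qed.

Lemma lin_convl g : lin (fun f => conv f g).
Proof.
move=> a f1 f2; apply/lfunP => h; rewrite !lfunE /= lfunE /= !conv_swE.
rewrite (sw_scaler (W := F^o)) /sw /tlift -big_split; apply: eq_bigr => i _ /=.
rewrite -big_split; apply: eq_bigr => j _ /=.
by rewrite -scalerDr !lfunE /= lfunE /= mulrDl scalerAl.
Qed.

Lemma lin_convr f : lin (fun g => conv f g).
Proof.
move=> a g1 g2; apply/lfunP => h; rewrite !lfunE /= lfunE /= !conv_swE.
rewrite (sw_scaler (W := F^o)) /sw /tlift -big_split; apply: eq_bigr => i _ /=.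
rewrite -big_split; apply: eq_bigr => j _ /=.
by rewrite -scalerDr !lfunE /= lfunE /= mulrDr scalerAr.
Qed.

Lemma conv_mem A B f g : f \in A -> g \in B -> conv f g \in convv A B.
Proof.
move=> /coord_vbasis -> /coord_vbasis ->.
rewrite (linsum (lin_convl _)); apply: memv_suml => i _.
rewrite (linZ (lin_convl _)) (linsum (lin_convr _)); apply: memvZ.
apply: memv_suml => j _; rewrite (linZ (lin_convr _)); apply: memvZ.
by apply/memv_span/allpairs_f; apply: mem_nth; rewrite size_tuple.
Qed.

Lemma convv_ind A B (P : dual H -> Prop) :
    P 0 -> (forall a u v, P u -> P v -> P (a *: u + v)) ->
    (forall f g, f \in A -> g \in B -> P (conv f g)) ->
  forall f, f \in convv A B -> P f.
Proof.
move=> P0 PD PAB; apply: span_ind => // _ /allpairsP[[f g] /= [Af Bg ->]].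
by apply: PAB; apply: vbasis_mem.
Qed.

(** A form vanishing on H K^+ is the pullback of its own restriction to the complement on which the
    quotient is realized. *)
Lemma hquot_dualP (K : {aspace H}) f :
  f \in hquot_dual K <-> {in ({:H} * aug K)%VS, forall u, f u = 0}.
Proof.
split=> [/memv_imgP[g _ ->] u Ku|f0].
  rewrite dual_mapE lfunE /=.
  suff : hquot_proj K u == 0 by move/eqP ->; rewrite linear0.
  by rewrite -memv_ker lker_quot_proj.
apply/memv_imgP; exists (f \o linfun (vsval : hquot K -> H))%VF.
  exact: memvf.
apply/lfunP => x; rewrite dual_mapE lfunE /= lfunE /= lfunE /= quot_projE.
set U := ({:H} * aug K)%VS in f0 *.
have UC : (U^C :&: U = 0)%VS by rewrite capvC capv_compl.
have xU : x \in (U^C + U)%VS by rewrite addvC addv_complf memvf.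
by rewrite -{1}(daddv_pi_add UC xU) linearD /= [X in _ + X]f0 ?addr0 ?memv_pi.
Qed.

End Convolution.

Section Restriction.
Variables (F : fieldType) (H : hopfAlgType F) (K : {aspace H}).
Hypothesis hopfK : hopf_subalgebra K.

Let rho (V : Defs.repr H) : 'Hom(subvs_of K, 'M[F]_(rdeg V)) :=
  (rmat V \o linfun (vsval : subvs_of K -> H))%VF.

Let rhoE V a : rho V a = V (vsval a).
Proof. by rewrite lfunE /= lfunE. Qed.

Let rho1 V : rho V 1 = 1%:M.
Proof.
rewrite rhoE -(rmat1 V); congr (V _).
by apply/eqP; rewrite algid_eq1 (hopf_mem1 hopfK).
Qed.

Let rhoM V a b : rho V (a * b) = rho V a *m rho V b.
Proof. by rewrite !rhoE -rmatM. Qed.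

Definition resr V : Defs.repr (subvs_of K) := Repr (rho1 V) (@rhoM V).

Lemma resrE V a : resr V a = V (vsval a).
Proof. exact: rhoE. Qed.

Lemma subr_resr V x : x \in K -> subr (resr V) x = V x.
Proof. by move=> Kx; rewrite /subr resrE vsprojK. Qed.

Lemma rchar_resr V : rchar (resr V) = res K (rchar V).
Proof. by apply/lfunP => a; rewrite resE !rcharE resrE. Qed.

End Restriction.

(** * Clifford theory for a normal Hopf subalgebra *)

Section Clifford.
Variables (F : fieldType) (H : hopfAlgType F) (K : {aspace H}).
Hypotheses (hopfK : hopf_subalgebra K) (normK : hopf_normal K).
Hypothesis ssH : semisimple_alg H.
Implicit Types V W : Defs.repr H.

(** The element x - eps(x) 1 lies in K^+, where f vanishes. *)
Lemma hquot_dual_mem (f : dual H) x :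
  f \in hquot_dual K -> x \in K -> f x = eps x * f 1.
Proof.
move=> /hquot_dualP f0 Kx.
have xK : x - eps x *: 1 \in ({:H} * aug K)%VS.
  rewrite -[x - _]mul1r memv_mul ?memvf //; apply/augP.
  rewrite memvB ?memvZ ?(hopf_mem1 hopfK) //; split=> //.
  by rewrite /eps linearB linearZ /= counit1 [_ *: 1]mulr1 subrr.
by have := f0 _ xK; rewrite linearB linearZ /= => /eqP; rewrite subr_eq0 => /eqP.
Qed.

(** For a in L^* and x in K, a(x1) b(x2) = eps(x1) a(1) b(x2) = a(1) b(x). *)
Lemma convv_restr W (f : dual H) :
    f \in convv (hquot_dual K) (coef_space W) ->
  exists M : 'M_(rdeg W), {in K, forall x, f x = \tr (M *m W x)}.
Proof.
pose P (g : dual H) :=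
  exists M : 'M_(rdeg W), {in K, forall x, g x = \tr (M *m W x)}.
apply: (@convv_ind _ _ _ _ P).
- by exists 0 => a _; rewrite lfunE mul0mx mxtrace0.
- move=> c u v [M uE] [N vE]; exists (c *: M + N) => x Kx.
  by rewrite !lfunE /= lfunE /= uE // vE // mulmxDl -scalemxAl linearP.
move=> a b La /coef_spaceP[M bE]; exists (a 1 *: M) => x Kx.
rewrite conv_swE -scalemxAl mxtraceZ -bE.
transitivity (sw (fun p q => eps p *: (a 1 * b q : F^o)) x).
  apply: (eq_sw_in hopfK) => //; try lin.
  move=> p q Kp Kq; rewrite (hquot_dual_mem La) //.
  exact: (esym (mulrA _ _ _)).
by rewrite (sw_counitl (f := fun q => a 1 * b q : F^o)) //; lin.
Qed.

Lemma rhom_restr_gt0 (S : Defs.repr (subvs_of K)) W :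
    (0 < rdeg S)%N ->
    (forall i j, exists M : 'M_(rdeg W),
       {in K, forall x, subr S x i j = \tr (M *m W x)}) ->
  (0 < \dim (rhom S (resr hopfK W)))%N.
Proof.
move=> S0 SW; rewrite lt0n dimv_eq0; apply/negP => /eqP rhom0.
have [t tP et] := normalized_integral hopfK normK ssH.
have Kt := proj1 tP.
have avg0 (X : 'M_(rdeg W, rdeg S)) : @avg _ _ _ t S (resr hopfK W) X = 0.
  by apply/eqP; rewrite -memv0 -rhom0 avg_hom.
(* This is the combination, with coefficients M_ij, of the (j, l) entries of the averages of the
   matrix units E_ik. *)
have tr0 (M : 'M_(rdeg W)) k l :
    sw (fun p q => \tr (M *m W p) * subr S (antipode q) k l : F^o) t = 0.
  transitivity (\sum_i \sum_j
      M i j *: ((@avg _ _ _ t S (resr hopfK W) (delta_mx i k)) j l : F^o));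
    last first.
    by apply: big1 => i _; apply: big1 => j _; rewrite avg0 mxE scaler0.
  transitivity (sw (fun p q => \sum_i \sum_j
      M i j *: ((subr (resr hopfK W) p *m delta_mx i k *m subr S (antipode q)) j l
       : F^o)) t); last first.
    rewrite sw_sum; apply: eq_bigr => i _; rewrite sw_sum; apply: eq_bigr => j _.
    apply/esym.
    apply: (linsw (f := fun X : 'M[F]_(rdeg W, rdeg S) => M i j *: (X j l : F^o))).
    lin.
  apply: (eq_sw_in hopfK) => //; try lin.
  move=> p q Kp Kq; rewrite subr_resr // /mxtrace mulr_suml.
  apply: eq_bigr => i _; rewrite mxE mulr_suml; apply: eq_bigr => j _.
  rewrite mulmx_delta_mulmxE; exact: (esym (mulrA _ _ _)).
(* A diagonal entry of t1 S(t2) acting on S is eps(t) = 1, yet by [SW] each entry is a sum of terms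
   as in [tr0]. *)
have := sw_subr_antipoder hopfK S Kt.
rewrite et => /matrixP/(_ (Ordinal S0) (Ordinal S0)).
rewrite [RHS]mxE eqxx => /eqP; rewrite -[_ == _]negbK => /negP; apply.
suff -> : sw (fun p q => subr S p *m subr S (antipode q)) t = 0.
  by rewrite mxE eq_sym oner_eq0.
apply/matrixP => i l; rewrite [RHS]mxE.
transitivity (sw (fun p q =>
    \sum_j (subr S p i j * subr S (antipode q) j l : F^o)) t).
  rewrite [LHS](linsw (f := fun X : 'M[F]_(rdeg S) => X i l : F^o)); last by lin.
  by apply: (@eq_sw F H (F^o : vectType F)) => p q; rewrite mxE.
rewrite sw_sum; apply: big1 => j _; have [M ME] := SW i j.
rewrite -(tr0 M j l); apply: (eq_sw_in hopfK (W := F^o : vectType F)) => //; try lin.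
by move=> p q Kp Kq; rewrite ME.
Qed.

Lemma coef_space_sub_convv V W (phi : 'M[F]_(rdeg V, rdeg W)) :
    simple_repr V -> phi != 0 -> {in K, forall x, phi *m W x = V x *m phi} ->
  (coef_space V <= convv (hquot_dual K) (coef_space W))%VS.
Proof.
move=> [V0 simV] phi0 phiK; set D := convv _ _.
pose psi (a : H) : 'M[F]_(rdeg V, rdeg W) :=
  sw (fun c d => V c *m phi *m W (antipode d)) a.
have psiL : lin psi by rewrite /psi; lin.
(* As phi is K-linear, psi(g x) = V(g1) phi W(x1 S(x2)) W(S(g2)), which has the factor eps(x) =
   0. *)
have psiK : {in ({:H} * aug K)%VS, forall u, psi u = 0}.
  move=> u; pose f := linfun psi.
  have fE : f =1 psi by exact: linfunE.
  rewrite -fE => uHK; apply/eqP; rewrite -memv_ker; move: u uHK; apply/subvP/prodvP.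
  move=> g x _ /augP[Kx ex]; rewrite memv_ker fE /psi; apply/eqP.
  rewrite swM; try lin.
  apply: sw_zero => a b.
  transitivity (V a *m phi *m subr (resr hopfK W)
      (sw (fun p q => p * antipode q) x) *m W (antipode b)); last first.
    by rewrite sw_antipoder ex scale0r /subr !linear0 ?mulmx0 mul0mx.
  rewrite (linsw (f := subr (resr hopfK W))); last by apply: lin_subr.
  rewrite sw_mulmxr sw_mulmxl.
  apply: (eq_sw_in hopfK) => //; try lin.
  move=> p q Kp Kq; rewrite subr_resr ?memvM ?(hopf_memS hopfK) //.
  by rewrite antipodeM !rmatM !mulmxA -[V a *m V p *m phi]mulmxA -phiK // mulmxA.
have Vphi h : V h *m phi = sw (fun a b => psi a *m W b) h.
  transitivity (sw (fun a b => sw (fun c d => V c *m phi *m W (antipode d) *m W b) a) h);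
    last by apply: eq_sw => a b; rewrite sw_mulmxl.
  rewrite swA; try lin.
  rewrite -(sw_counitr (f := fun a => V a *m phi)); last by lin.
  apply: eq_sw => a r; transitivity (V a *m phi *m W (eps r *: 1)).
    by rewrite linearZ /= rmat1 -scalemxAr mulmx1.
  rewrite -sw_antipodel (linsw (f := rmat W)); last by move=> ???; rewrite linearP.
  by rewrite sw_mulmxr; apply: eq_sw => c d; rewrite rmatM !mulmxA.
(* Expanding V(h g) phi as psi(h1 g1) W(h2 g2) puts these forms in L^* C_W: right translates of the
   entries of psi still vanish on the two-sided ideal H K^+. *)
pose coefg g i l : dual H := linfun (fun h => (V (h * g) *m phi) i l : F^o).
have coefgE g i l h : coefg g i l h = (V (h * g) *m phi) i l.
  by rewrite linfunE //; lin.
have coefgD g i l : coefg g i l \in D.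
  pose psic c k : dual H := linfun (fun h => psi (h * c) i k : F^o).
  have psicE c k h : psic c k h = psi (h * c) i k.
    by rewrite linfunE // /psi; lin.
  have psicL c k : psic c k \in hquot_dual K.
    apply/hquot_dualP => u uHK; rewrite psicE psiK ?mxE //.
    exact: haug_mulr.
  suff -> : coefg g i l = sw (fun c d => \sum_k \sum_m
      W d m l *: conv (psic c k) (rcoef k m)) g.
    apply: memv_suml => a _; apply: memv_suml => b _; apply: memvZ.
    apply: memv_suml => k _; apply: memv_suml => m _; apply: memvZ.
    by apply: conv_mem => //; apply: rcoef_mem.
  apply/lfunP => h; rewrite coefgE Vphi.
  rewrite (linsw (f := fun u : dual H => u h : F^o)); last first.
    by move=> a u v; rewrite lfunE /= lfunE.
  rewrite swM; try (rewrite /psi; lin).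
  rewrite [LHS](linsw (f := fun M : 'M[F]_(_, _) => M i l : F^o)); last by lin.
  transitivity (sw (fun p q => sw (fun r s =>
     (psi (p * r) *m W (q * s)) i l : F^o) g) h).
    apply: eq_sw => p q.
    by apply: (linsw (f := fun M : 'M[F]_(rdeg V, rdeg W) => M i l : F^o)); lin.
  rewrite sw_exchange; apply: eq_sw => c d.
  rewrite sum_lfunE.
  transitivity (sw (fun p q => \sum_k \sum_m
     W d m l *: (psi (p * c) i k * W q k m : F^o)) h).
    apply: eq_sw => p q; rewrite mxE; apply: eq_bigr => k _.
    rewrite rmatM mxE mulr_sumr; apply: eq_bigr => m _.
    by rewrite mulrA [LHS]mulrC.
  rewrite sw_sum; apply: eq_bigr => k _; rewrite sum_lfunE.
  rewrite sw_sum; apply: eq_bigr => m _; rewrite lfunE /= conv_swE sw_scaler.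
  by apply: eq_sw => p q; rewrite psicE rcoefE.
have [w w0] : exists w : 'cV_(rdeg W), phi *m w != 0.
  have [//|now] := pselect (exists w : 'cV_(rdeg W), phi *m w != 0).
  case/eqP: phi0; apply: eq_colP => j; rewrite !colE mul0mx.
  by apply: contrapT => /eqP phij; apply: now; exists (delta_mx j 0).
(* By simplicity phi w generates V, so each basis vector is V(g) phi w for some g, and a coefficient
   of V is a combination of the [coefg] g i l with coefficients w_l. *)
pose gen := linfun (fun h => V h *m (phi *m w)).
have genE h : gen h = V h *m (phi *m w) by rewrite linfunE //; lin.
have subgen : submodule (limg gen).
  move=> a _ /memv_imgP[h _ ->]; apply/memv_imgP; exists (a * h); first exact: memvf.
  by rewrite !genE rmatM mulmxA.
have genT : limg gen = fullv.
  case: (simV _ subgen) => // gen0; case/eqP: w0; apply/eqP.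
  rewrite -memv0 -gen0; apply/memv_imgP; exists 1; first exact: memvf.
  by rewrite genE rmat1 mul1mx.
apply/span_subvP => _ /allpairsP[[i k] [_ _ ->]] /=.
have : (delta_mx k 0 : 'cV_(rdeg V)) \in limg gen by rewrite genT memvf.
case/memv_imgP => g _ gE.
suff -> : rcoef i k = \sum_l w l 0 *: coefg g i l.
  by apply: memv_suml => l _; apply/memvZ/coefgD.
apply/lfunP => h; rewrite rcoefE sum_lfunE.
transitivity ((V h *m delta_mx k 0 : 'cV_(rdeg V)) i 0); first by rewrite -colE mxE.
rewrite gE genE !mulmxA -rmatM -mulmxA mulmxA mxE; apply: eq_bigr => l _.
by rewrite lfunE /= coefgE mulrC.
Qed.

Hypothesis char0 : forall n, (n%:R == 0 :> F) = (n == 0)%N.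

Lemma irr_rel_restr chi mu : Irr chi -> Irr mu ->
  irr_rel K chi mu <->
  exists psi : dual (subvs_of K),
    irr_constituent psi (res K chi) /\ irr_constituent psi (res K mu).
Proof.
move=> /simple_coalgP[V [simV <- VE]] /simple_coalgP[W [simW <- WE]].
rewrite /irr_rel VE WE; split=> [sub|[psi [[S [V1 [simS <- V1E homV]]]
    [S2 [W2 [_ S2E W2E homW]]]]]].
  have [|S [B [B' [simS B'B VB]]]] := @simple_submodule _ _ (resr hopfK V).
    exact: simV.1.
  exists (rchar S); split; [exists S, (resr hopfK V) | exists S, (resr hopfK W)].
    rewrite rchar_resr; split=> //.
    rewrite lt0n dimv_eq0; apply/negP => /eqP rhom0.
    have : B \in rhom S (resr hopfK V) by apply/mem_rhom => a; rewrite VB.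
    rewrite rhom0 memv0 => /eqP B0.
    move: B'B; rewrite B0 mulmx0 => /matrixP.
    case: simS => S0 _ => /(_ (Ordinal S0) (Ordinal S0))/eqP.
    by rewrite !mxE eqxx eq_sym oner_eq0.
  rewrite rchar_resr; split=> //; apply: rhom_restr_gt0; first exact: simS.1.
  move=> i j.
  have Vcoef k l : exists M : 'M_(rdeg W), {in K, forall x, V x k l = \tr (M *m W x)}.
    have [M ME] := convv_restr (subvP sub _ (rcoef_mem k l)).
    by exists M => x Kx; rewrite -ME // rcoefE.
  pose N k l := sval (cid (Vcoef k l)).
  have NE k l : {in K, forall x, V x k l = \tr (N k l *m W x)}.
    by rewrite /N; case: cid.
  (* On K the action on S is B' V B, so its entries combine those of V, which [N] expresses through
     W. *)
  exists (\sum_k \sum_l (B' i k * B l j) *: N k l) => x Kx.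
  have -> : subr S x = B' *m V x *m B.
    rewrite -mulmxA -(subr_resr hopfK V Kx) /subr VB mulmxA B'B mul1mx //.
  rewrite mulmx_suml linear_sum /=.
  rewrite [LHS]mxE; under [LHS]eq_bigr => l _ do rewrite mxE mulr_suml.
  rewrite exchange_big; apply: eq_bigr => k _ /=.
  rewrite mulmx_suml linear_sum; apply: eq_bigr => l _ /=.
  by rewrite -scalemxAl mxtraceZ -NE // mulrAC.
have [t tP et] := normalized_integral hopfK normK ssH.
(* The modules in [irr_constituent] only share their characters with the restrictions of V and W,
   and by [rhom_gt0] the characters decide. *)
have homV' : (0 < \dim (rhom S (resr hopfK V)))%N.
  by move: homV; rewrite !(rhom_gt0 hopfK tP et char0) rchar_resr V1E.
have homW' : (0 < \dim (rhom S (resr hopfK W)))%N.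
  by move: homW; rewrite !(rhom_gt0 hopfK tP et char0) rchar_resr W2E S2E.
have nz (A B : Defs.repr (subvs_of K)) : (0 < \dim (rhom A B))%N ->
    exists2 X, X \in rhom A B & X != 0.
  move=> AB; exists (vpick (rhom A B)); first exact: memv_pick.
  by rewrite vpick0 -dimv_eq0 -lt0n.
have [X XP X0] := nz _ _ homV'; have [Y YP Y0] := nz _ _ homW'.
have [Z ZY] := simple_mono simS (proj1 (mem_rhom Y) YP) Y0.
(* Z is only a linear left inverse of Y; its average is K-linear and still satisfies avg(Z) Y =
   avg(Z Y) = 1, so the composite with X is nonzero. *)
apply: (@coef_space_sub_convv _ _ (X *m @avg _ _ _ t (resr hopfK W) S Z)) => //.
  apply: contraNneq X0 => phi0; rewrite -[X]mulmx1 -(avg1 hopfK tP et S) -ZY.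
  by rewrite -(avg_mulr hopfK tP _ YP) mulmxA phi0 mul0mx.
move=> x Kx; rewrite -!(subr_resr hopfK) // -mulmxA.
have /(rhomP) -> // := avg_hom hopfK tP (A := resr hopfK W) (B := S) Z.
by rewrite mulmxA; have /rhomP -> // := XP; rewrite mulmxA.
Qed.

End Clifford.

Theorem proposition4p2 (R : realType) (H : hopfAlgType R[i]) (K : {aspace H})
    (ssH : semisimple_alg H) (hopfK : hopf_subalgebra K)
    (normK : hopf_normal K) (chi mu : dual H)
    (irr_chi : Irr chi) (irr_mu : Irr mu) :
  irr_rel K chi mu <->
  exists psi : dual (subvs_of K),
    irr_constituent psi (res K chi) /\ irr_constituent psi (res K mu).
Proof.
by apply: irr_rel_restr => // n; rewrite Num.Theory.pnatr_eq0.
Qed.
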